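(* Let $T=\{1342,1423,2314\}$. Then $$F_T(x)=\frac{1-3x+x^2}{1-x}\,C^3(x).$$
   Context: $S_n(T)$ denotes the set of permutations $\pi$ of $[n]=\{1,\dots,n\}$ (one-line notation) that avoid every pattern $\tau\in T$, i.e. no subsequence of $\pi$ is order-isomorphic to $\tau$. $F_T(x)=\sum_{n\ge 0}|S_n(T)|x^n$, a formal power series, with $|S_0(T)|=1$. $C(x)=\frac{1-\sqrt{1-4x}}{2x}=\sum_{n\ge0}\frac{1}{n+1}\binom{2n}{n}x^n$ is the generating function of the Catalan numbers, and $C^3(x)=(C(x))^3$. *)

(* Defs.v *)
From HB Require Import structures.
From mathcomp Require Import all_boot all_order all_algebra all_fingroup.
From mathcomp Require Import boolp.
Set Implicit Arguments.
Unset Strict Implicit.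
Unset Printing Implicit Defensive.
Import GRing.Theory.
Local Open Scope ring_scope.

(* A wrapper around nat -> K is needed: the bare function type would be        *)
(* multiplied pointwise.                                                       *)
Record fps (K : Type) := FPS { fps_coef : nat -> K }.

Declare Scope fps_scope.
Delimit Scope fps_scope with fps.
Notation "f `@_ n" := (fps_coef f n)
  (at level 3, n at level 2, left associativity, format "f `@_ n") : fps_scope.
Open Scope fps_scope.

Lemma fpsP (K : Type) (f g : fps K) : (forall n, f`@_n = g`@_n) <-> f = g.
Proof.
split=> [|-> //]; case: f => f; case: g => g /= fg.
by congr FPS; apply: funext.
Qed.

HB.instance Definition _ (K : Type) := gen_eqMixin (fps K).
HB.instance Definition _ (K : Type) := gen_choiceMixin (fps K).

Section FpsRing.
Variable K : fieldType.
Implicit Types f g h : fps K.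

Definition fps_const (c : K) : fps K := FPS (fun n => c *+ (n == 0)%N).
Definition fps_add f g : fps K := FPS (fun n => f`@_n + g`@_n).
Definition fps_opp f : fps K := FPS (fun n => - f`@_n).
Definition fps_mul f g : fps K :=
  FPS (fun n => \sum_(i < n.+1) f`@_i * g`@_(n - i)).

Fact fps_addA : associative fps_add.
Proof. by move=> f g h; apply/fpsP => n /=; rewrite addrA. Qed.
Fact fps_addC : commutative fps_add.
Proof. by move=> f g; apply/fpsP => n /=; rewrite addrC. Qed.
Fact fps_add0 : left_id (fps_const 0) fps_add.
Proof. by move=> f; apply/fpsP => n /=; rewrite mul0rn add0r. Qed.
Fact fps_addN : left_inverse (fps_const 0) fps_opp fps_add.
Proof. by move=> f; apply/fpsP => n /=; rewrite mul0rn addNr. Qed.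

HB.instance Definition _ :=
  GRing.isZmodule.Build (fps K) fps_addA fps_addC fps_add0 fps_addN.

Definition fps_trunc m f : {poly K} := \poly_(i < m.+1) f`@_i.

Fact fps_trunc_coef m f i : (i <= m)%N -> (fps_trunc m f)`_i = f`@_i.
Proof. by move=> le_im; rewrite coef_poly ltnS le_im. Qed.

Fact fps_mul_trunc m f g n : (n <= m)%N ->
  (fps_mul f g)`@_n = (fps_trunc m f * fps_trunc m g)`_n.
Proof.
move=> le_nm; rewrite coefM /=; apply: eq_bigr => i _.
rewrite !fps_trunc_coef //; first by rewrite (leq_trans (leq_subr _ _)).
by rewrite (leq_trans _ le_nm) // -ltnS.
Qed.

Fact fps_mulC : commutative fps_mul.
Proof.
by move=> f g; apply/fpsP => n; rewrite !(fps_mul_trunc _ _ (leqnn n)) mulrC.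
Qed.

Fact fps_mulA : associative fps_mul.
Proof.
move=> f g h; apply/fpsP => n.
transitivity (fps_trunc n f * (fps_trunc n g * fps_trunc n h))`_n.
  rewrite coefM /=; apply: eq_bigr => i _.
  rewrite (fps_trunc_coef f (leq_ord i)); congr (_ * _).
  exact: (fps_mul_trunc _ _ (leq_subr _ _)).
rewrite mulrA coefM /=; apply: eq_bigr => i _.
rewrite (fps_trunc_coef _ (leq_subr _ _)); congr (_ * _).
by rewrite -(fps_mul_trunc _ _ (m := n)) // -ltnS.
Qed.

Fact fps_mul1 : left_id (fps_const 1) fps_mul.
Proof.
move=> f; apply/fpsP => n /=.
rewrite big_ord_recl /= subn0 mul1r big1 ?addr0 // => i _.
by rewrite /= mul0r.
Qed.

Fact fps_mulDl : left_distributive fps_mul fps_add.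
Proof.
move=> f g h; apply/fpsP => n /=; rewrite -big_split /=.
by apply: eq_bigr => i _; rewrite mulrDl.
Qed.

Fact fps_one_neq0 : fps_const 1 != 0.
Proof.
by apply/eqP => /fpsP/(_ 0%N) /= /eqP; rewrite mulr1n oner_eq0.
Qed.

HB.instance Definition _ := GRing.Zmodule_isComNzRing.Build (fps K)
  fps_mulA fps_mulC fps_mul1 fps_mulDl fps_one_neq0.

(* Listing of the first n.+1 coefficients of f^-1, obtained by solving         *)
(* f * f^-1 = 1 degree by degree.                                              *)
Fixpoint fps_inv_seq f n : seq K :=
  if n is m.+1 then
    let s := fps_inv_seq f m in
    rcons s (- (f`@_0)^-1 * \sum_(i < m.+1) f`@_(m.+1 - i) * s`_i)
  else [:: (f`@_0)^-1].

Definition fps_unit : pred (fps K) := fun f => f`@_0 != 0.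

(* As required of a unitRingType, a non-unit is its own inverse.               *)
Definition fps_inv f : fps K :=
  if fps_unit f then FPS (fun n => (fps_inv_seq f n)`_n) else f.

Fact size_fps_inv_seq f n : size (fps_inv_seq f n) = n.+1.
Proof. by elim: n => //= n IHn; rewrite size_rcons IHn. Qed.

Fact nth_fps_inv_seq f n i : (i <= n)%N ->
  (fps_inv_seq f n)`_i = (fps_inv_seq f i)`_i.
Proof.
elim: n => [|n IHn]; first by rewrite leqn0 => /eqP->.
rewrite leq_eqVlt => /orP[/eqP-> //|lt_in].
by rewrite /= nth_rcons size_fps_inv_seq lt_in IHn.
Qed.

Fact fps_mulV : {in fps_unit, left_inverse 1 fps_inv *%R}.
Proof.
move=> f f_unit; rewrite mulrC; apply/fpsP => n.
rewrite /fps_inv; have f0 : f`@_0 != 0 := f_unit; rewrite ifT //.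
case: n => [|n].
  by rewrite /GRing.mul /= big_ord_recl big_ord0 addr0 /= mulfV.
rewrite [LHS]/= (reindex_inj rev_ord_inj) /= big_ord_recr /=.
rewrite !subSS subnn subn0 nth_rcons size_fps_inv_seq ltnn eqxx.
rewrite mulrA mulrN mulfV // mulN1r.
rewrite mulr0n; apply/eqP; rewrite subr_eq0; apply/eqP.
apply: eq_bigr => i _; rewrite !subSS.
have lt_in : (i <= n)%N by rewrite -ltnS.
by rewrite (nth_fps_inv_seq _ lt_in) subKn // ltnW.
Qed.

Fact fps_unitPl f g : g * f = 1 -> fps_unit f.
Proof.
move=> /fpsP/(_ 0%N); rewrite /= big_ord_recl big_ord0 addr0 /= => gf1.
apply/eqP => f0; move/eqP: gf1; rewrite f0 mulr0 eq_sym.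
by rewrite mulr1n oner_eq0.
Qed.

Fact fps_inv_out : {in [predC fps_unit], fps_inv =1 id}.
Proof. by move=> f; rewrite inE /fps_inv => /negPf fN; rewrite ifF. Qed.

HB.instance Definition _ := GRing.ComNzRing_hasMulInverse.Build (fps K)
  fps_mulV fps_unitPl fps_inv_out.

Definition fpsX : fps K := FPS (fun n => (n == 1%N)%:R).

End FpsRing.

Arguments fpsX {K}.

Section PatternAvoidance.
Local Open Scope nat_scope.

Definition order_isomorphic (s t : seq nat) : bool :=
  (size s == size t) &&
  [forall i : 'I_(size s), forall j : 'I_(size s),
     (nth 0 s i < nth 0 s j) == (nth 0 t i < nth 0 t j)].

(* The subsequences of w are the mask m w, for m a bit vector of length        *)
(* size w.                                                                     *)
Definition contains_pattern (w tau : seq nat) : bool :=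
  [exists m : (size w).-tuple bool, order_isomorphic (mask m w) tau].

(* 'S_n permutes {0, ..., n-1}, hence the shift by one.                        *)
Definition one_line n (pi : 'S_n) : seq nat := [seq (pi i).+1 | i <- enum 'I_n].

Definition avoiders (T : seq (seq nat)) (n : nat) : {set 'S_n} :=
  [set pi : 'S_n | all (fun tau => ~~ contains_pattern (one_line pi) tau) T].

End PatternAvoidance.

Definition avoiders_gf (T : seq (seq nat)) : fps rat :=
  FPS (fun n => #|avoiders T n|%:R).

Definition catalan_gf : fps rat :=
  FPS (fun n => n.+1%:R^-1 * 'C(2 * n, n)%:R).

(* Main.v *)
Require Import Defs.
From mathcomp Require Import all_boot all_order all_algebra all_fingroup.
From mathcomp Require Import zify ring lra.
Set Implicit Arguments.
Unset Strict Implicit.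
Unset Printing Implicit Defensive.
Import GRing.Theory Num.Theory.

(* Build the permutations by inserting n, n - 1, ..., 1 in turn, each value
   being the new minimum.  Inserting a new minimum between u and v preserves
   avoidance iff v avoids 231 and 312 and no entry of u with a smaller entry
   before it is exceeded by an entry of v.  The words that arise have one of
   two shapes, A(d, m) with d + m active sites and B(k) with k + 1 active
   sites, and the generating tree is
     A(d, m) -> A(d + 1, 0), A(2, 1), ..., A(d - 1, 1), A(d, m + 1), B(2)^m
     B(k)    -> A(2, 0), B(k + 1), B(2)^(k - 1)        (d, k >= 2)
   with A(2, 0) as the single word of length 1.  The generating functions of
   the subtrees are affine in m and k, and the remaining recurrence in d is
   c_(d+1) = c_d + x c_(d+2), solved by powers of C because C = 1 + x C^2. *)

(** * Insertion of a new minimum *)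

Lemma subseq_cat_split (T : eqType) (s u v : seq T) : subseq s (u ++ v) ->
  exists s1 s2, [/\ s = s1 ++ s2, subseq s1 u & subseq s2 v].
Proof.
elim: u s => [|b u IHu] [|c s] /= su; try by exists [::], [::]; rewrite sub0seq.
  by exists [::], (c :: s).
case: (eqVneq c b) su => [-> | ne] /IHu[s1 [s2 [def_s s1u s2v]]].
  by exists (b :: s1), s2; rewrite def_s /= eqxx.
exists s1, s2; split=> //; exact: subseq_trans (subseq_cons u b).
Qed.

Lemma subseq_insert (T : eqType) (s u v : seq T) a : subseq s (u ++ a :: v) ->
  subseq s (u ++ v) \/
  exists s1 s2, [/\ s = s1 ++ a :: s2, subseq s1 u & subseq s2 v].
Proof.
case/subseq_cat_split=> s1 [[|b s2] [-> s1u /= s2v]].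
  by left; rewrite cat_subseq ?sub0seq.
case: (eqVneq b a) s2v => [-> | _] s2v; last by left; rewrite cat_subseq.
by right; exists s1, s2.
Qed.

Lemma subseq_uninsert (T : eqType) (u v : seq T) a :
  subseq (u ++ v) (u ++ a :: v).
Proof. by rewrite cat_subseq // subseq_cons. Qed.

(* [x; y; z] is order-isomorphic to 231 or 312. *)
Definition bad3 x y z := (z < x < y) || (y < z < x).
(* [x; y; z; t] is order-isomorphic to 1342, 1423 or 2314. *)
Definition bad4 x y z t :=
  [|| [&& x < t, t < y & y < z], [&& x < z, z < t & t < y]
    | [&& z < x, x < y & y < t]].

Definition avoiding (w : seq nat) :=
  forall x y z t : nat, subseq [:: x; y; z; t] w -> ~~ bad4 x y z t.

Definition insertable (u v : seq nat) :=
  (forall x y z : nat, subseq [:: x; y; z] v -> ~~ bad3 x y z) /\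
  (forall x y z : nat, subseq [:: x; y] u -> z \in v -> ~~ (x < y < z)).

(** A new occurrence uses [a], which as the minimum plays the 1. In 1342 and 1423 the 1 comes first,
    so the rest is a 231 or 312 in [v]; in 2314 it comes third, so an ascent of [u] is topped by an
    entry of [v]. *)
Lemma avoiding_insert (u v : seq nat) a : {in u ++ v, forall b, a < b} ->
  avoiding (u ++ v) -> avoiding (u ++ a :: v) <-> insertable u v.
Proof.
move=> lt_a av; split=> [avi|[lay nasc] x y z t].
  split=> [x y z sv|x y z su zv].
    have /avi: subseq [:: a; x; y; z] (u ++ a :: v).
      rewrite -[_ :: _]/([::] ++ a :: [:: x; y; z]).
      by rewrite cat_subseq ?sub0seq //= eqxx.
    have lt: forall b, b \in [:: x; y; z] -> a < b.
      by move=> b bs; apply: lt_a; rewrite mem_cat (mem_subseq sv bs) orbT.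
    move: (lt x) (lt y) (lt z); rewrite /= !inE !eqxx /= ?orbT /bad3 /bad4; lia.
  have /avi: subseq [:: x; y; a; z] (u ++ a :: v).
    rewrite -[_ :: _]/([:: x; y] ++ a :: [:: z]) cat_subseq //= eqxx //.
    by rewrite sub1seq.
  have lt: forall b, b \in [:: x; y; z] -> a < b.
    move=> b; rewrite (inE, mem_cat) => bs; apply: lt_a; rewrite mem_cat.
    move: (mem_subseq su (x := b)); rewrite !inE in bs *.
    case/or3P: bs => /eqP->; rewrite ?eqxx ?orbT ?zv ?orbT //.
      by move=> ->.
    by move=> ->.
  move: (lt x) (lt y) (lt z); rewrite /= !inE !eqxx /= ?orbT /bad4; lia.
case/subseq_insert => [|[s1 [s2 [def_s s1u s2v]]]]; first exact: av.
have lt b : b \in s1 ++ s2 -> a < b.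
  rewrite mem_cat => /orP bs; apply: lt_a; rewrite mem_cat.
  by case: bs => [/(mem_subseq s1u)|/(mem_subseq s2v)] ->; rewrite ?orbT.
(* The length of [s1] is the place of [a] in the pattern; a minimum cannot be second or fourth. *)
case: s1 s1u lt def_s => [|x1 [|x2 [|x3 [|x4 s1]]]] s1u lt [].
- move=> -> def_s; rewrite -def_s in s2v lt.
  move: (lay _ _ _ s2v) (lt y) (lt z) (lt t).
  rewrite /= !inE !eqxx /= ?orbT /bad3 /bad4; lia.
- move=> -> -> def_s; rewrite -def_s in s2v lt.
  move: (lt x1) (lt z) (lt t).
  by rewrite /= !inE !eqxx /= ?orbT /bad4; lia.
- move=> -> -> -> def_s; rewrite -def_s in s2v lt; rewrite sub1seq in s2v.
  move: (lt x1) (lt x2) (lt t) (nasc _ _ _ s1u s2v).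
  by rewrite /= !inE !eqxx /= ?orbT /bad4; lia.
- move=> -> -> -> -> _; move: (lt x1) (lt x2) (lt x3).
  by rewrite /= !inE !eqxx /= ?orbT /bad4; lia.
- by move=> _ _ _ _ /(congr1 size); rewrite size_cat /= addnS.
Qed.

(** As the minimum of the right part, [a] can only end a 231, which needs an ascent of [mid], or be
    the middle of a 312, which needs a descent from [mid] to [v]. It is too small to top an ascent
    of [u]. *)
Lemma insertable_left (u mid v : seq nat) a :
    {in u ++ mid ++ v, forall b, a < b} ->
  insertable u (mid ++ a :: v) <->
  [/\ insertable u (mid ++ v), forall x y : nat, subseq [:: x; y] mid -> y <= x
    & {in mid & v, forall x y : nat, x <= y}].
Proof.
move=> lt_a; have sub := subseq_uninsert mid v a.
split=> [[lay nasc]|[[lay nasc] dec le]].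
  split; first split.
  - by move=> x y z s; apply: lay; apply: subseq_trans sub.
  - by move=> x y z s zv; apply: nasc s _; apply: (mem_subseq sub).
  - move=> x y s.
    have xm : x \in mid by apply: (mem_subseq s); rewrite inE eqxx.
    have /lay : subseq [:: x; y; a] (mid ++ a :: v).
      by rewrite -[_ :: _]/([:: x; y] ++ [:: a]) cat_subseq // sub1seq inE eqxx.
    have : a < x by apply: lt_a; rewrite !mem_cat xm orbT.
    rewrite /bad3; lia.
  move=> x y xm yv.
  have /lay : subseq [:: x; a; y] (mid ++ a :: v).
    rewrite -[_ :: _]/([:: x] ++ [:: a; y]) cat_subseq ?sub1seq //=.
    by rewrite eqxx sub1seq.
  have : a < y by apply: lt_a; rewrite !mem_cat yv !orbT.
  rewrite /bad3; lia.
split=> x y z; last first.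
  move=> s; rewrite mem_cat inE => zv.
  case: (eqVneq z a) => [->|za].
    have : a < x by apply: lt_a; rewrite mem_cat (mem_subseq s) // inE eqxx.
    lia.
  apply: nasc s _; rewrite mem_cat.
  by case/or3P: zv za => [->|->|->]; rewrite ?orbT.
case/subseq_insert => [|[s1 [s2 [def_s s1m s2v]]]]; first exact: lay.
have lt b : b \in s1 ++ s2 -> a < b.
  rewrite mem_cat => /orP bs; apply: lt_a; rewrite !mem_cat.
  by case: bs => [/(mem_subseq s1m)|/(mem_subseq s2v)] ->; rewrite ?orbT.
case: s1 s1m lt def_s => [|x1 [|x2 [|x3 s1]]] s1m lt [].
- move=> -> def_s; rewrite -def_s in lt.
  by move: (lt y) (lt z); rewrite /= !inE !eqxx /= ?orbT /bad3; lia.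
- move=> -> -> def_s; rewrite -def_s in s2v lt; rewrite !sub1seq in s1m s2v.
  move: (lt x1) (lt z) (le _ _ s1m s2v).
  by rewrite /= !inE !eqxx /= ?orbT /bad3; lia.
- move=> -> -> -> _; move: (lt x1) (lt x2) (dec _ _ s1m).
  by rewrite /= !inE !eqxx /= ?orbT /bad3; lia.
- by move=> _ _ _ /(congr1 size); rewrite size_cat /= addnS.
Qed.

(** Placed before [mid], [a] turns every entry of [mid] into the top of an ascent, so no entry of
    [v] may exceed it. Ascents inside [u] are covered by the earlier insertability. *)
Lemma insertable_right (u mid v : seq nat) a :
    {in u ++ mid ++ v, forall b, a < b} ->
  insertable u (mid ++ v) ->
  insertable (u ++ a :: mid) v <-> {in mid & v, forall y z : nat, z <= y}.
Proof.
move=> lt_a [lay nasc]; split=> [[_ nasc'] y z ym zv|ge].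
  have /nasc'/(_ zv) : subseq [:: a; y] (u ++ a :: mid).
    rewrite -[_ :: _]/([::] ++ [:: a; y]) cat_subseq ?sub0seq //=.
    by rewrite eqxx sub1seq.
  have : a < y by apply: lt_a; rewrite !mem_cat ym orbT.
  lia.
split=> x y z => [s|].
  by apply: lay; apply: subseq_trans s _; apply: suffix_subseq.
have nmid t : t \in mid -> z \in v -> z <= t by move=> tm zv; apply: ge.
case/subseq_insert=> [s zv|[s1 [s2 [def_s s1u s2m]]] zv]; last first.
  have lt b : b \in s1 -> a < b.
    by move/(mem_subseq s1u) => bs; apply: lt_a; rewrite mem_cat bs.
  case: s1 s1u lt def_s => [|x1 [|x2 s1]] s1u lt [].
  - move=> -> def_s; rewrite -def_s sub1seq in s2m.
    by have := nmid _ s2m zv; lia.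
  - by move=> -> -> _; move: (lt x1); rewrite /= inE eqxx; lia.
  - by move=> _ _ /(congr1 size); rewrite size_cat /= addnS.
case/subseq_cat_split: s => s1 [s2 [def_s s1u s2m]].
(* Unless [y] is in [mid], the whole ascent lies in [u]: a nonempty part in [mid] would contain its
   last entry [y]. *)
have [ym|] := boolP (y \in mid); first by have := nmid _ ym zv; lia.
case/lastP: s2 s2m def_s => [|s2 y'] s2m; last first.
  rewrite -rcons_cat => /(congr1 (last 0)); rewrite last_rcons /= => -> /negP[].
  by apply: (mem_subseq s2m); rewrite mem_rcons inE eqxx.
rewrite cats0 => def_s _; rewrite -def_s in s1u.
by apply: nasc s1u _; rewrite mem_cat zv orbT.
Qed.

(** * Sites of a word and the effect of an insertion on them *)

Definition insert_at p a (w : seq nat) := take p w ++ a :: drop p w.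

Definition active p w := insertable (take p w) (drop p w).

Lemma size_insert_at p a (w : seq nat) : size (insert_at p a w) = (size w).+1.
Proof. by rewrite size_cat /= addnS -size_cat cat_take_drop. Qed.

Lemma nth_insert_at p a (w : seq nat) i : p <= size w ->
  nth 0 (insert_at p a w) i =
  if i < p then nth 0 w i else if i == p then a else nth 0 w i.-1.
Proof.
move=> le_pw; rewrite nth_cat size_takel //.
have [lt_ip|le_pi] := ltnP i p; first by rewrite nth_take.
case: (eqVneq i p) => [->|ne_ip]; first by rewrite subnn.
have [k def_i] : exists k, i = (p + k).+1 by exists (i - p).-1; lia.
by rewrite def_i -addnS addKn /= nth_drop addnS.
Qed.

Lemma mem_insert_at p a (w : seq nat) : insert_at p a w =i a :: w.
Proof.
move=> x; rewrite mem_cat !inE orbCA -mem_cat cat_take_drop.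
by case: (x == a).
Qed.

Lemma mem_drop_take p q (w : seq nat) x : x \in drop p (take q w) ->
  exists i, [/\ p <= i, i < q, i < size w & x = nth 0 w i].
Proof.
case/(nthP 0) => i; rewrite size_drop size_take_min nth_drop => lt_i <-.
have {}lt_i : i < minn q (size w) - p := lt_i.
by exists (p + i); split; rewrite ?nth_take //; lia.
Qed.

Lemma nth_mem_drop_take p q (w : seq nat) i :
  p <= i < q -> i < size w -> nth 0 w i \in drop p (take q w).
Proof.
move=> pq lt_iw; apply/(nthP 0); exists (i - p).
  by rewrite size_drop size_take_min; change (i - p < minn q (size w) - p); lia.
by rewrite nth_drop subnKC ?nth_take //; lia.
Qed.

Lemma nth_mem_drop p (w : seq nat) i :
  p <= i -> i < size w -> nth 0 w i \in drop p w.
Proof.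
move=> pi lt_iw; rewrite -[w in drop p w](take_oversize (leqnn _)).
by rewrite nth_mem_drop_take // pi.
Qed.

Lemma subseq_nth2 (s : seq nat) i j :
  i < j < size s -> subseq [:: nth 0 s i; nth 0 s j] s.
Proof.
move=> ij; rewrite -[s in subseq _ s](cat_take_drop j).
rewrite -[_ :: _]/([:: nth 0 s i] ++ [:: nth 0 s j]) cat_subseq ?sub1seq //.
  by rewrite -(drop0 (take j s)) nth_mem_drop_take; lia.
by apply: nth_mem_drop; lia.
Qed.

Lemma subseq_nth3 (s : seq nat) i j k : i < j -> j < k < size s ->
  subseq [:: nth 0 s i; nth 0 s j; nth 0 s k] s.
Proof.
move=> ij jk; rewrite -[s in subseq _ s](cat_take_drop k).
rewrite -[_ :: _]/([:: nth 0 s i; nth 0 s j] ++ [:: nth 0 s k]).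
rewrite cat_subseq ?sub1seq ?nth_mem_drop //; try lia.
rewrite -(@nth_take k) -1?(@nth_take k _ _ j); try lia.
by apply: subseq_nth2; rewrite size_take_min; lia.
Qed.

Lemma subseq2_nth (s : seq nat) x y : subseq [:: x; y] s ->
  exists i j, [/\ i < j, j < size s, x = nth 0 s i & y = nth 0 s j].
Proof.
elim: s => [|b s IHs] //=; case: (eqVneq x b) => [->|_].
  by rewrite sub1seq => /(nthP 0)[j lt_js <-]; exists 0, j.+1.
by case/IHs => i [j [lt_ij lt_js -> ->]]; exists i.+1, j.+1.
Qed.

Lemma avoiding_insert_at p a (w : seq nat) : {in w, forall b, a < b} ->
  avoiding w -> avoiding (insert_at p a w) <-> active p w.
Proof.
by rewrite -{1 2}(cat_take_drop p w); exact: avoiding_insert.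
Qed.

(** This is [insertable_left] with [mid] the entries from [q] to [p]. Sites up to [p] keep their
    index, [p] becoming the site just before [a]. *)
Lemma active_insert_left p q a (w : seq nat) : {in w, forall b, a < b} ->
    q <= p <= size w ->
  active q (insert_at p a w) <->
  [/\ active q w, forall i j, q <= i < j -> j < p -> nth 0 w j <= nth 0 w i
    & forall i j, q <= i < p -> p <= j < size w -> nth 0 w i <= nth 0 w j].
Proof.
move=> lt_a qp.
have cat_w : drop q (take p w) ++ drop p w = drop q w.
  rewrite -{3}(cat_take_drop p w) drop_cat size_takel; last lia.
  case: ltnP => // le_pq; have -> : q = p by lia.
  by rewrite subnn drop0 drop_oversize // size_takel; lia.
have := @insertable_left (take q w) (drop q (take p w)) (drop p w) a.
rewrite cat_w cat_take_drop => /(_ lt_a).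
have -> : insertable (take q w) (drop q (take p w) ++ a :: drop p w) =
   active q (insert_at p a w).
  rewrite /active /insert_at take_cat drop_cat size_takel; last lia.
  case: ltnP => [lt_qp|le_pq]; first by rewrite take_takel //; lia.
  have -> : q = p by lia.
  by rewrite subnn take0 cats0 drop0 drop_oversize // size_takel; lia.
move=> ->; rewrite -/(active q w).
split=> [[act dec le]|[act dec le]]; split=> //.
- move=> i j qij lt_jp; apply: dec.
  have := @subseq_nth2 (drop q (take p w)) (i - q) (j - q).
  rewrite size_drop size_take_min !nth_drop !subnKC; try lia.
  by rewrite !nth_take; [apply|..]; lia.
- move=> i j qip pj.
  by apply: le; [apply: nth_mem_drop_take|apply: nth_mem_drop]; lia.
- move=> x y /subseq2_nth[i [j [ij]]].
  rewrite size_drop size_take_min !nth_drop => lt_j -> ->.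
  by rewrite !nth_take; [apply: dec|..]; lia.
move=> x y /mem_drop_take[i [qi ip iw ->]] yv.
have /mem_drop_take[j [pj _ jw ->]] : y \in drop p (take (size w) w).
  by rewrite take_size.
by apply: le; lia.
Qed.

(** Sites from [p] on move up by one; the old site [p] also yields [p.+1], the site just after
    [a]. *)
Lemma active_insert_right p q a (w : seq nat) : {in w, forall b, a < b} ->
    active p w -> p <= q <= size w ->
  active q.+1 (insert_at p a w) <->
  forall i j, p <= i < q -> q <= j < size w -> nth 0 w j <= nth 0 w i.
Proof.
move=> lt_a act pq.
have cat_w : drop p (take q w) ++ drop q w = drop p w.
  rewrite -{3}(cat_take_drop q w) drop_cat size_takel; last lia.
  case: ltnP => // le_qp; have -> : q = p by lia.
  by rewrite subnn drop0 drop_oversize // size_takel; lia.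
have := @insertable_right (take p w) (drop p (take q w)) (drop q w) a.
rewrite cat_w cat_take_drop => /(_ lt_a act).
have -> : insertable (take p w ++ a :: drop p (take q w)) (drop q w) =
   active q.+1 (insert_at p a w).
  rewrite /active /insert_at take_cat drop_cat size_takel; last lia.
  rewrite ltnNge leqW /=; last lia.
  rewrite subSn /=; last lia.
  by rewrite drop_drop take_drop !subnK //; lia.
move=> ->; split=> [le i j pi qj|le x y /mem_drop_take[i [pi iq iw ->]] yv].
  by apply: le; [apply: nth_mem_drop_take|apply: nth_mem_drop]; lia.
have /mem_drop_take[j [qj _ jw ->]] : y \in drop q (take (size w) w).
  by rewrite take_size.
by apply: le; lia.
Qed.

(** For distinct entries, avoiding 231 and 312 means being layered: decreasing runs, each above the
    previous one. *)
Lemma active_layered p (w : seq nat) i j k :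
    active p w -> p <= i -> i < j < k -> k < size w ->
  ~~ bad3 (nth 0 w i) (nth 0 w j) (nth 0 w k).
Proof.
case=> lay _ pi ijk kw; apply: lay.
have := @subseq_nth3 (drop p w) (i - p) (j - p) (k - p).
by rewrite !nth_drop size_drop !subnKC; [apply|..]; lia.
Qed.

(** * The generating tree *)

(* Write w = u ++ t ++ v with |u| = s and |u ++ t| = e.  In both states t is
   decreasing and lies below v.  State A(d, m): v is decreasing, the active
   sites are those from the start of t on, d = |v| + 1 and m = |t|.  State
   B(k): v has an ascent, the active sites are those from the start of t to
   the start of v and the end of w, and k = |t| + 1. *)
Record stateA s e (w : seq nat) : Prop := StateA {
  stateA_le : s <= e;
  stateA_lt : e < size w;
  stateA_active : forall p, p <= size w -> active p w <-> s <= p;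
  stateA_dec : forall i j, e <= i < j -> j < size w -> nth 0 w j < nth 0 w i;
  stateA_top : forall i j, s <= i < j -> j < e -> nth 0 w j < nth 0 w i;
  stateA_sep : forall i j, s <= i < e -> e <= j < size w ->
    nth 0 w i < nth 0 w j }.

Record stateB s e (w : seq nat) : Prop := StateB {
  stateB_le : s <= e;
  stateB_lt : e < size w;
  stateB_active : forall p, p <= size w ->
    active p w <-> (s <= p <= e) || (p == size w);
  stateB_asc : exists i j, [/\ e <= i < j, j < size w & nth 0 w i < nth 0 w j];
  stateB_top : forall i j, s <= i < j -> j < e -> nth 0 w j < nth 0 w i;
  stateB_sep : forall i j, s <= i < e -> e <= j < size w ->
    nth 0 w i < nth 0 w j }.

Section Transitions.
Variables (a : nat) (w : seq nat).
Hypothesis gt_a : {in w, forall b, a < b}.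

Let gt_nth i : i < size w -> a < nth 0 w i.
Proof. by move=> lt_iw; apply/gt_a/mem_nth. Qed.

Let active_left (P : nat -> Prop) p q :
    (forall r, r <= size w -> active r w <-> P r) -> q <= p <= size w ->
  active q (insert_at p a w) <->
  [/\ P q, forall i j, q <= i < j -> j < p -> nth 0 w j <= nth 0 w i
    & forall i j, q <= i < p -> p <= j < size w -> nth 0 w i <= nth 0 w j].
Proof.
move=> act le_qp; apply: iff_trans (active_insert_left gt_a le_qp) _.
have act_q : active q w <-> P q by apply: act; lia.
by split=> -[/act_q].
Qed.

Let active_right (P : nat -> Prop) p q :
    (forall r, r <= size w -> active r w <-> P r) -> P p -> p <= q <= size w ->
  active q.+1 (insert_at p a w) <->
  forall i j, p <= i < q -> q <= j < size w -> nth 0 w j <= nth 0 w i.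
Proof.
move=> act Pp le_pq; apply: active_insert_right => //.
by apply/act => //; lia.
Qed.

(** [a] prolongs the decreasing [v]. Sites before [e] die because [t] lying below [v] puts an ascent
    before [a]. *)
Lemma stateA_insert_end s e : stateA s e w ->
  stateA e e (insert_at (size w) a w).
Proof.
move=> [le_se lt_ew act dec top sep].
split; rewrite ?size_insert_at //; try lia; first last.
- move=> i j ij jn; rewrite !nth_insert_at //.
  by move: (dec i j) (gt_nth (i := i)); repeat case: ifP; lia.
move=> q le_q; case: (leqP q (size w)) => [le_qw|].
  rewrite (active_left act); last lia.
  split=> [[sq dec' _]|eq]; last first.
    by split=> [|i j ij jn|i j]; [lia|move: (dec i j); lia|lia].
  rewrite leqNgt; apply/negP=> qe.
  by move: (dec' q e) (sep q e); lia.
case: q le_q => // q le_q lt_q; rewrite (active_right act); try lia.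
by split=> [_|_ i j]; lia.
Qed.

(** The entry before [a] exceeds the one after it, which kills the sites left of [p]; the sites to
    the right survive since [v] is decreasing. *)
Lemma stateA_insert_dec s e p : stateA s e w -> e < p < size w ->
  stateA p p.+1 (insert_at p a w).
Proof.
move=> [le_se lt_ew act dec top sep] p_int; have le_pw : p <= size w by lia.
split; rewrite ?size_insert_at //; try lia.
- move=> q le_q; case: (leqP q p) => [le_qp|].
    rewrite (active_left act); last lia.
    split=> [[sq _ le]|pq]; last by split=> [|i j|i j]; lia.
    rewrite leqNgt; apply/negP=> qp.
    by move: (le p.-1 p) (dec p.-1 p); lia.
  case: q le_q => // q le_q lt_pq; rewrite (active_right act); try lia.
  by split=> [_|_ i j pi qj]; first lia; move: (dec i j); lia.
- move=> i j ij jn; rewrite !nth_insert_at //.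
  by move: (dec i.-1 j.-1); repeat case: ifP; lia.
- move=> i j ij jn; rewrite !nth_insert_at //.
  by move: (gt_nth (i := j.-1)); repeat case: ifP; lia.
Qed.

(** [a] prolongs [t], and no site from [s] on dies. *)
Lemma stateA_insert_sep s e : stateA s e w ->
  stateA s e.+1 (insert_at e a w).
Proof.
move=> [le_se lt_ew act dec top sep]; have le_ew : e <= size w by lia.
split; rewrite ?size_insert_at //; try lia.
- move=> q le_q; case: (leqP q e) => [le_qp|].
    rewrite (active_left act); last lia.
    split=> [[]//|sq]; split=> [|i j qij je|i j qi ej] //; last first.
      by move: (sep i j); lia.
    by move: (top i j); lia.
  case: q le_q => // q le_q lt_pq; rewrite (active_right act); try lia.
  by split=> [_|_ i j pi qj]; first lia; move: (dec i j); lia.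
- move=> i j ij jn; rewrite !nth_insert_at //.
  by move: (dec i.-1 j.-1); repeat case: ifP; lia.
- move=> i j ij jn; rewrite !nth_insert_at //.
  by move: (top i j) (gt_nth (i := i)); repeat case: ifP; lia.
- move=> i j ij jn; rewrite !nth_insert_at //.
  by move: (sep i j.-1) (gt_nth (i := j.-1)); repeat case: ifP; lia.
Qed.

(** Sites left of [p] die since [t] is decreasing. Sites further right die since the entry of [t]
    after [a] lies below the end of [v]. The two sites around [a] and the end remain. *)
Lemma stateA_insert_top s e p : stateA s e w -> s <= p < e ->
  stateB p p.+1 (insert_at p a w).
Proof.
move=> [le_se lt_ew act dec top sep] p_int; have le_pw : p <= size w by lia.
split; rewrite ?size_insert_at //; try lia.
- move=> q le_q; case: (leqP q p) => [le_qp|].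
    rewrite (active_left act); last lia.
    split=> [[sq _ le]|pq]; last by split=> [|i j|i j]; lia.
    suff : p <= q by lia.
    rewrite leqNgt; apply/negP=> qp.
    by move: (le p.-1 p) (top p.-1 p); lia.
  case: q le_q => // q le_q lt_pq; rewrite (active_right act); try lia.
  split=> [le|q_eq i j pi qj]; last by move: (dec i j); lia.
  suff : ~ (p < q < size w) by lia.
  by move=> pq; move: (le p (size w).-1) (sep p (size w).-1); lia.
(* The ascent from the rest of [t] to the last entry of [v], shifted by the insertion. *)
- exists p.+1, (size w); rewrite !nth_insert_at //; split; try lia.
  by move: (sep p (size w).-1); rewrite /=; repeat case: ifP; lia.
- move=> i j ij jn; rewrite !nth_insert_at //.
  by move: (gt_nth (i := j.-1)); repeat case: ifP; lia.
Qed.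

(** The ascent of [v] now precedes [a], which kills the sites up to [e]; the two sites around [a]
    remain. *)
Lemma stateB_insert_end s e : stateB s e w ->
  stateA (size w) (size w) (insert_at (size w) a w).
Proof.
move=> [le_se lt_ew act [i0 [j0 [ij0 jw0 asc]]] top sep].
split; rewrite ?size_insert_at //; try lia.
move=> q le_q; case: (leqP q (size w)) => [le_qw|].
  rewrite (active_left act); last lia.
  split=> [[q_act dec _]|q_eq]; last by split=> [|i j|i j]; lia.
  rewrite leqNgt; apply/negP=> qp.
  by move: (dec i0 j0); lia.
case: q le_q => // q le_q lt_q; rewrite (active_right act); try lia.
by split=> [_|_ i j]; lia.
Qed.

(** A site strictly inside [v] would need a prefix of [v] dominating the rest, which a layered word
    with an ascent does not allow. *)
Lemma stateB_insert_sep s e : uniq w -> stateB s e w ->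
  stateB s e.+1 (insert_at e a w).
Proof.
move=> uniq_w [le_se lt_ew act [i0 [j0 [ij0 jw0 asc]]] top sep].
have le_ew : e <= size w by lia.
have act_e : active e w by apply/act => //; lia.
split; rewrite ?size_insert_at //; try lia.
- move=> q le_q; case: (leqP q e) => [le_qp|].
    rewrite (active_left act); last lia.
    split=> [[]|sq]; first lia; split=> [|i j qij je|i j qi ej]; first lia.
      by move: (top i j); lia.
    by move: (sep i j); lia.
  case: q le_q => // q le_q lt_pq; rewrite (active_right act); try lia.
  split=> [le|q_eq i j pi qj]; last lia.
  suff : ~ (e < q < size w) by lia.
  move=> eq.
  have neq i j : i < j < size w -> nth 0 w i <> nth 0 w j.
    case/andP=> ij jw /eqP; rewrite (nth_uniq 0 (ltn_trans ij jw) jw uniq_w).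
    by move/eqP=> def_i; rewrite def_i ltnn in ij.
  (* An ascent from [q] on forms a 312 with entry [e], one before [q] forms a 231 with entry [q],
     and one across [q] contradicts [le]. *)
  case: (leqP q i0) => [qi0|i0q].
    have := active_layered act_e (leqnn e) (j := i0) (k := j0).
    by move: (le e i0) (le e j0) (neq e j0); rewrite /bad3; lia.
  case: (ltnP j0 q) => [j0q|qj0]; last by move: (le i0 j0); lia.
  have := active_layered act_e (i := i0) (j := j0) (k := q).
  by move: (le i0 q) (le j0 q) (neq i0 q); rewrite /bad3; lia.
- exists i0.+1, j0.+1; rewrite !nth_insert_at //; split; try lia.
  by rewrite /=; repeat case: ifP; lia.
- move=> i j ij jn; rewrite !nth_insert_at //.
  by move: (top i j) (gt_nth (i := i)); repeat case: ifP; lia.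
- move=> i j ij jn; rewrite !nth_insert_at //.
  by move: (sep i j.-1) (gt_nth (i := j.-1)); repeat case: ifP; lia.
Qed.

Lemma stateB_insert_top s e p : stateB s e w -> s <= p < e ->
  stateB p p.+1 (insert_at p a w).
Proof.
move=> [le_se lt_ew act [i0 [j0 [ij0 jw0 asc]]] top sep] p_int.
have le_pw : p <= size w by lia.
split; rewrite ?size_insert_at //; try lia.
- move=> q le_q; case: (leqP q p) => [le_qp|].
    rewrite (active_left act); last lia.
    split=> [[sq _ le]|pq]; last by split=> [|i j|i j]; lia.
    suff : p <= q by lia.
    rewrite leqNgt; apply/negP=> qp.
    by move: (le p.-1 p) (top p.-1 p); lia.
  case: q le_q => // q le_q lt_pq; rewrite (active_right act); try lia.
  split=> [le|q_eq i j pi qj]; last lia.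
  suff : ~ (p < q < size w) by lia.
  by move=> pq; move: (le p (size w).-1) (sep p (size w).-1); lia.
- exists i0.+1, j0.+1; rewrite !nth_insert_at //; split; try lia.
  by rewrite /=; repeat case: ifP; lia.
- move=> i j ij jn; rewrite !nth_insert_at //.
  by move: (gt_nth (i := j.-1)); repeat case: ifP; lia.
Qed.

End Transitions.

(** * Pattern containment as the predicate [avoiding] *)

Lemma contains_patternP w tau :
  reflect (exists2 s, subseq s w & order_isomorphic s tau)
    (contains_pattern w tau).
Proof.
apply: (iffP existsP) => [[m iso]|[s /subseqP[m size_m ->] iso]].
  by exists (mask m w); rewrite ?mask_subseq.
by exists (Tuple (introT eqP size_m)).
Qed.

Lemma order_isomorphicP s t :
  reflect (size s = size t /\ forall i j, i < size s -> j < size s ->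
             (nth 0 s i < nth 0 s j) = (nth 0 t i < nth 0 t j))
    (order_isomorphic s t).
Proof.
apply: (iffP andP) => [[/eqP size_st /forallP iso]|[-> iso]].
  split=> // i j lt_is lt_js.
  by have /forallP/(_ (Ordinal lt_js))/eqP := iso (Ordinal lt_is).
split=> //; apply/forallP => i; apply/forallP => j; apply/eqP.
exact: iso.
Qed.

Definition forbidden :=
  [:: [:: 1; 3; 4; 2]; [:: 1; 4; 2; 3]; [:: 2; 3; 1; 4]].

Definition avoids w := all (fun tau => ~~ contains_pattern w tau) forbidden.

Lemma order_isomorphic_forbidden x y z t :
  has (order_isomorphic [:: x; y; z; t]) forbidden = bad4 x y z t.
Proof.
have iso4 tau : size tau = 4 -> order_isomorphic [:: x; y; z; t] tau =
    all (fun i => all (fun j =>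
    (nth 0 [:: x; y; z; t] i < nth 0 [:: x; y; z; t] j)
    == (nth 0 tau i < nth 0 tau j)) (iota 0 4)) (iota 0 4).
  move=> size_tau; apply/order_isomorphicP/allP => [[_ iso] i | iso].
    rewrite mem_iota => lt_i; apply/allP => j; rewrite mem_iota => lt_j.
    exact/eqP/iso.
  split=> // i j lt_i lt_j.
  have := iso i; rewrite mem_iota lt_i => /(_ isT)/allP/(_ j).
  by rewrite mem_iota => /(_ lt_j)/eqP.
by rewrite /= !iso4 //= /bad4 !ltnn /=; lia.
Qed.

Lemma avoidsP w : reflect (avoiding w) (avoids w).
Proof.
rewrite /avoids all_predC; apply: (iffP hasPn) => [av x y z t s|av tau tau_in].
  rewrite -order_isomorphic_forbidden; apply/hasPn => tau /av.
  by apply: contra => iso; apply/contains_patternP; exists [:: x; y; z; t].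
apply/negP=> /contains_patternP[s sw iso].
have : size s = 4.
  case/order_isomorphicP: iso => -> _; move: tau_in.
  by rewrite !inE => /or3P[] /eqP->.
case: s sw iso => [|x [|y [|z [|t []]]]] // /av/negP + iso _; apply.
by rewrite -order_isomorphic_forbidden; apply/hasP; exists tau.
Qed.

Lemma avoids_subseq w1 w2 : subseq w1 w2 -> avoids w2 -> avoids w1.
Proof.
move=> s12 /avoidsP av; apply/avoidsP => x y z t s1.
exact/av/(subseq_trans s1).
Qed.

(** * Permutations as completions of the empty word *)

Fixpoint completions a w :=
  if a is b.+1 then
    [seq s | p <- iota 0 (size w).+1, s <- completions b (insert_at p a w)]
  else [:: w].

Lemma completionsS a w : completions a.+1 w =
  [seq s | p <- iota 0 (size w).+1, s <- completions a (insert_at p a.+1 w)].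
Proof. by []. Qed.

Lemma completions_subseq a (w s : seq nat) :
  s \in completions a w -> subseq w s.
Proof.
elim: a w s => [|a IHa] w s; first by rewrite inE => /eqP->.
case/allpairsPdep => p [t [_ /IHa t_in ->]]; apply: subseq_trans t_in.
by rewrite -{1}(cat_take_drop p w); apply: subseq_uninsert.
Qed.

Lemma completions_perm a (w s : seq nat) :
  s \in completions a w -> perm_eq s (iota 1 a ++ w).
Proof.
elim: a w s => [|a IHa] w s; first by rewrite inE => /eqP->.
case/allpairsPdep => p [t [_ /IHa t_in ->]]; move/permPl: t_in => ->.
rewrite -(addn1 a) iotaD -catA perm_cat2l add1n addn1 /=.
by rewrite perm_catC /= perm_cons perm_catC cat_take_drop.
Qed.

Lemma insert_at_gt p a (w : seq nat) : {in w, forall b, a.+1 < b} ->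
  {in insert_at p a.+1 w, forall b, a < b}.
Proof.
move=> gt_a b; rewrite mem_insert_at inE => /orP[/eqP-> //|/gt_a].
exact: ltnW.
Qed.

Lemma filter_insert_at p a (w : seq nat) : {in w, forall b, a < b} ->
  [seq x <- insert_at p a w | a < x] = w.
Proof.
move=> gt_a; rewrite filter_cat /= ltnn -filter_cat cat_take_drop.
by apply/all_filterP/allP.
Qed.

(** Only values up to [a] are inserted. Hence a completion determines the branch it came from, and
    branches are disjoint. *)
Lemma completions_filter a (w s : seq nat) : {in w, forall b, a < b} ->
  s \in completions a w -> [seq x <- s | a < x] = w.
Proof.
elim: a w s => [|a IHa] w s gt_a.
  by rewrite inE => /eqP->; apply/all_filterP/allP.
case/allpairsPdep => p [t [_ t_in ->]].
rewrite -(filter_insert_at p gt_a) -(IHa _ _ (insert_at_gt gt_a) t_in).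
rewrite -filter_predI; apply: eq_filter => x /=.
by apply/idP/andP=> [lt_ax|[]//]; rewrite lt_ax ltnW.
Qed.

Lemma insert_at_inj a (w : seq nat) : a \notin w ->
  {in gtn (size w).+1 &, injective (fun p => insert_at p a w)}.
Proof.
move=> a_w p q; rewrite !inE !ltnS => pw qw /(congr1 (index a)).
have idx r : r <= size w -> index a (insert_at r a w) = r.
  move=> rw; rewrite index_cat ifN; last first.
    by apply: contra a_w; apply: mem_take.
  by rewrite /= eqxx addn0 size_takel.
by rewrite !idx.
Qed.

Lemma completions_uniq a (w : seq nat) :
  {in w, forall b, a < b} -> uniq (completions a w).
Proof.
elim: a w => [|a IHa] w gt_a //; rewrite completionsS.
apply: (@allpairs_uniq_dep nat (fun=> seq nat) _ (fun _ s => s)).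
  exact: iota_uniq.
  by move=> p _; apply: IHa; apply: insert_at_gt.
move=> _ _ /allpairsPdep[p [s [p_in s_in ->]]]
    /allpairsPdep[q [t [q_in t_in ->]]].
rewrite /= => eq_st; rewrite eq_st in s_in *.
rewrite mem_iota in p_in; rewrite mem_iota in q_in.
suff -> : p = q by [].
have a_w : a.+1 \notin w by apply/negP=> /gt_a; rewrite ltnn.
apply: (insert_at_inj a_w); [exact: p_in|exact: q_in|rewrite /=].
rewrite -(completions_filter (insert_at_gt gt_a) s_in).
by rewrite -(completions_filter (insert_at_gt gt_a) t_in).
Qed.

Lemma size_completions a (w : seq nat) :
  size (completions a w) = \prod_(1 <= i < a.+1) (size w + i).
Proof.
elim: a w => [|a IHa] w; first by rewrite big_nil.
rewrite completionsS size_allpairs_dep big_nat_recl // addn1.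
rewrite sumnE big_map; under eq_bigr do rewrite IHa size_insert_at.
rewrite big_const_seq count_predT size_iota iter_addn_0 mulnC.
congr (_ * _).
by apply: eq_bigr => i _; rewrite addSnnS.
Qed.

Definition navoid a w := count avoids (completions a w).

Lemma navoid0 w : navoid 0 w = avoids w.
Proof. by rewrite /navoid /= addn0. Qed.

Lemma navoidS a (w : seq nat) :
  navoid a.+1 w = \sum_(0 <= p < (size w).+1) navoid a (insert_at p a.+1 w).
Proof.
rewrite /navoid completionsS count_flatten -!map_comp sumnE big_map.
rewrite /index_iota subn0.
by apply: eq_bigr => p _ /=; rewrite map_id.
Qed.

(** [w] is a subsequence of its completions, so a pattern once present persists and inactive sites
    can be pruned. *)
Lemma navoid_eq0 a (w : seq nat) : ~ avoiding w -> navoid a w = 0.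
Proof.
move=> nav; apply/eqP; rewrite -leqn0 leqNgt -has_count.
apply/negP=> /hasP[s /completions_subseq ws /(avoids_subseq ws)].
by move/avoidsP.
Qed.

Lemma one_line_perm n (pi : 'S_n) : perm_eq (one_line pi) (iota 1 n).
Proof.
apply: uniq_perm; rewrite ?iota_uniq //.
  by rewrite map_inj_uniq ?enum_uniq // => i j [] /val_inj/perm_inj.
move=> x; rewrite mem_iota add1n; apply/mapP/idP => [[i _ ->]|].
  by have := ltn_ord (pi i); lia.
case: x => // x /= lt_xn; rewrite ltnS in lt_xn.
by exists (pi^-1 (Ordinal lt_xn))%g; rewrite ?mem_enum ?permKV.
Qed.

Lemma one_line_inj n : injective (@one_line n).
Proof.
move=> pi sg /eq_in_map eq_one; apply/permP => i.
by apply/val_inj/succn_inj/eq_one; rewrite mem_enum.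
Qed.

Lemma card_avoiders n : #|avoiders forbidden n| = navoid n [::].
Proof.
have mem_compl : completions n [::] =i permutations (iota 1 n).
  have sub : {subset completions n [::] <= permutations (iota 1 n)}.
    by move=> s /completions_perm; rewrite cats0 mem_permutations.
  (* A list without repetition inside a list of the same length n! exhausts it. *)
  have [] // := uniq_min_size (completions_uniq (w := [::]) _) sub.
  rewrite size_permutations ?iota_uniq // size_iota size_completions.
  by rewrite fact_prod.
have mem_one : [seq one_line pi | pi : 'S_n] =i permutations (iota 1 n).
  have sub : {subset [seq one_line pi | pi : 'S_n] <= permutations (iota 1 n)}.
    by move=> s /mapP[pi _ ->]; rewrite mem_permutations one_line_perm.
  have [] // := uniq_min_size _ sub.
    by rewrite map_inj_uniq ?enum_uniq //; apply: one_line_inj.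
  rewrite size_permutations ?iota_uniq // size_iota size_map -cardE.
  by rewrite card_Sn.
rewrite /navoid.
have /seq.permP-> : perm_eq (completions n [::]) [seq one_line pi | pi : 'S_n].
  apply: uniq_perm; first exact: completions_uniq.
    by rewrite map_inj_uniq ?enum_uniq //; apply: one_line_inj.
  by move=> s; rewrite mem_compl mem_one.
by rewrite count_map cardsE cardE -size_filter enumT {1}/enum_mem.
Qed.

(** * Generating functions *)

Local Open Scope ring_scope.

Section FpsCoef.
Variable K : fieldType.
Implicit Types f g : fps K.

Lemma fps_coefD f g n : (f + g)`@_n = f`@_n + g`@_n. Proof. by []. Qed.

Lemma fps_coefN f n : (- f)`@_n = - f`@_n. Proof. by []. Qed.

Lemma fps_coef0 n : (0 : fps K)`@_n = 0. Proof. exact: mul0rn. Qed.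

Lemma fps_coef1 n : (1 : fps K)`@_n = (n == 0)%:R. Proof. by []. Qed.

Lemma fps_coefM f g n : (f * g)`@_n = \sum_(i < n.+1) f`@_i * g`@_(n - i).
Proof. by []. Qed.

Lemma fps_coef_natM k f n : (k%:R * f)`@_n = k%:R * f`@_n.
Proof.
rewrite !mulr_natl; elim: k => [|k IHk]; first exact: fps_coef0.
by rewrite !mulrSr fps_coefD IHk.
Qed.

Lemma fps_coef_sum (I : Type) (r : seq I) (P : pred I) (F : I -> fps K) n :
  (\sum_(i <- r | P i) F i)`@_n = \sum_(i <- r | P i) (F i)`@_n.
Proof. exact: (big_morph _ (fun f g => fps_coefD f g n) (fps_coef0 n)). Qed.

Lemma fps_coefXM0 f : (fpsX * f)`@_0 = 0.
Proof. by rewrite fps_coefM big_ord1 mul0r. Qed.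

Lemma fps_coefXMS f n : (fpsX * f)`@_n.+1 = f`@_n.
Proof.
rewrite fps_coefM !big_ord_recl /= mul0r add0r mul1r subn1 big1 ?addr0 //.
by move=> i _; rewrite /= mul0r.
Qed.

(** The Euler operator x d/dx, a derivation that does not shift indices. *)
Definition theta f : fps K := FPS (fun n => n%:R * f`@_n).

Lemma theta_coef f n : (theta f)`@_n = n%:R * f`@_n. Proof. by []. Qed.

Lemma thetaD f g : theta (f + g) = theta f + theta g.
Proof. by apply/fpsP => n; rewrite fps_coefD /= mulrDr. Qed.

Lemma thetaN f : theta (- f) = - theta f.
Proof. by apply/fpsP => n; rewrite fps_coefN /= mulrN. Qed.

Lemma theta1 : theta 1 = 0.
Proof. by apply/fpsP => -[|n]; rewrite fps_coef0 /= ?mul0r ?mulr0. Qed.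

Lemma thetaX : theta fpsX = fpsX.
Proof. by apply/fpsP => -[|[|n]] /=; rewrite ?mul0r ?mulr1 ?mulr0. Qed.

Lemma thetaM f g : theta (f * g) = theta f * g + f * theta g.
Proof.
apply/fpsP => n; rewrite fps_coefD !fps_coefM /= mulr_sumr -big_split /=.
apply: eq_bigr => i _.
have -> : n%:R = i%:R + (n - i)%:R :> K by rewrite -natrD subnKC // -ltnS.
ring.
Qed.

Lemma fps_1subX_unit : (1 - fpsX : fps K) \is a GRing.unit.
Proof.
change (fps_unit (1 - fpsX : fps K)).
by rewrite /fps_unit fps_coefD fps_coefN /= subr0 mulr1n oner_neq0.
Qed.

End FpsCoef.

(** * The quadratic equation of the Catalan series *)

Lemma central_binomS n :
  (n.+1 * 'C(2 * n.+1, n.+1) = 2 * (2 * n).+1 * 'C(2 * n, n))%N.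
Proof.
have e1 := mul_bin_diag (2 * n).+2 n.
have e2 := mul_bin_diag (2 * n).+1 n.
have e3 : 'C((2 * n).+1, n) = 'C((2 * n).+1, n.+1).
  by rewrite -bin_sub; [congr 'C(_, _)|]; lia.
move: e1 e2; rewrite /= e3 mulnS add2n.
set b := 'C(_, _); set c := 'C(_, _); set d := 'C(_, _); nia.
Qed.

Lemma catalan_coefS n :
  n.+2%:R * catalan_gf`@_n.+1 = (4 * n%:R + 2) * catalan_gf`@_n.
Proof.
rewrite /= mulVKf ?pnatr_eq0 //.
apply: (mulfI (_ : n.+1%:R != 0)); first by rewrite pnatr_eq0.
rewrite -[LHS]natrM central_binomS mulrCA mulVKf ?pnatr_eq0 //.
by rewrite !natrM -(natr1 (2 * n)) natrM; ring.
Qed.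

(** The ratio of consecutive coefficients gives a first-order differential equation for [C]; the
    defect [G] of the quadratic then satisfies a homogeneous one. *)
Lemma catalan_quadratic : catalan_gf = 1 + fpsX * catalan_gf ^+ 2.
Proof.
set C := catalan_gf; set X : fps rat := fpsX.
have ode : theta C * (1 - 4 * X) = 1 - C + 2 * X * C.
  have -> : theta C * (1 - 4 * X) = theta C - X * (4 * theta C) by ring.
  have -> : 1 - C + 2 * X * C = 1 - C + X * (2 * C) by ring.
  apply/fpsP => -[|n].
    by rewrite !(fps_coefD, fps_coefN) !fps_coefXM0 /= mul0r.
  rewrite !(fps_coefD, fps_coefN) !fps_coefXMS !fps_coef_natM !theta_coef.
  rewrite fps_coef1; have := catalan_coefS n; rewrite -(natr1 n.+1) -/C.
  rewrite -[(n.+1 == 0)%:R]/(0 : rat).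
  by move: C`@_n.+1 C`@_n (n.+1%:R : rat) (n%:R : rat) => c1 c0 n1 n0; lra.
pose G := 1 - C + X * C ^+ 2.
(* (1 - 4x) (x G') = - G forces G = 0, coefficient by coefficient. *)
have thG : theta G = 4 * (X * theta G) - G.
  have tG : theta G = - theta C + X * C ^+ 2 + 2 * X * C * theta C.
    by rewrite /G expr2 !(thetaD, thetaN, theta1, thetaM) thetaX -/X; ring.
  apply/eqP; rewrite -subr_eq0; apply/eqP.
  (* The factor [2 * X * C - 1] is the derivative of [G] with respect to [C]. *)
  have -> : theta G - (4 * (X * theta G) - G) =
      (theta C * (1 - 4 * X) - (1 - C + 2 * X * C)) * (2 * X * C - 1).
    by rewrite tG /G; ring.
  by rewrite ode subrr mul0r.
suff G0 : G = 0.
  by apply/eqP; rewrite eq_sym -subr_eq0 -G0 /G; apply/eqP; ring.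
have G_coef n : n%:R * G`@_n = 4 * (X * theta G)`@_n - G`@_n.
  by have /fpsP/(_ n) := thG; rewrite fps_coefD fps_coefN fps_coef_natM.
apply/fpsP; elim=> [|n IHn]; rewrite fps_coef0.
  have := G_coef 0; rewrite fps_coefXM0 mul0r mulr0 sub0r => /esym/eqP.
  by rewrite oppr_eq0 => /eqP.
have := G_coef n.+1; rewrite fps_coefXMS theta_coef IHn fps_coef0 !mulr0 sub0r.
move=> /eqP; rewrite -addr_eq0 -[X in _ + X]mul1r -mulrDl natr1.
by rewrite mulf_eq0 pnatr_eq0 => /eqP.
Qed.

(** * Solution of the recurrences of the tree *)

Section GeneratingFunctions.
Local Notation X := (fpsX : fps rat).
Local Notation C := catalan_gf.

(** The common slope of [gfA] in [m] and of [gfB] in [k]: what one more entry of [t] contributes. *)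
Definition beta_gf : fps rat := C ^+ 2 - (1 - X)^-1.

(** The value of [gfA k] at [m = 1], where the slope term vanishes. *)
Definition ladder_gf k : fps rat := (1 - X) * C ^+ k.+2.

(* [gfA d m] and [gfB k] count the descendants of A(d, m) and B(k + 2). *)
Definition gfA d m : fps rat := ladder_gf d + (m%:R - 1) * beta_gf.

Definition gfB k : fps rat := (1 - X) * (C ^+ 2 + C ^+ 3) - 1 + k%:R * beta_gf.

Lemma mulX_catalan_sq : X * C ^+ 2 = C - 1.
Proof. by rewrite {2}catalan_quadratic addrC addKr. Qed.

Lemma ladder_gf_rec k : ladder_gf k.+1 = ladder_gf k + X * ladder_gf k.+2.
Proof.
rewrite /ladder_gf (exprD C 2 k.+2 : C ^+ k.+4 = _) (exprS C k.+2).
move: (C ^+ k.+2) => c.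
transitivity ((1 - X) * c * (1 + X * C ^+ 2)); last by ring.
by rewrite mulX_catalan_sq; ring.
Qed.

(** One more entry of [t] adds one child B(2) and is inherited by the child that prolongs [t]. *)
Lemma beta_gf_eq : beta_gf = X * (beta_gf + gfB 0).
Proof.
have V : (1 - X) * (1 - X)^-1 = 1 by rewrite mulrV ?fps_1subX_unit.
have -> : X * (beta_gf + gfB 0) =
    X * beta_gf + (1 - X) * (X * C ^+ 2 + C * (X * C ^+ 2)) - X.
  by rewrite /gfB; ring.
rewrite mulX_catalan_sq; apply/eqP; rewrite -subr_eq0; apply/eqP.
transitivity (- ((1 - X) * (1 - X)^-1 - 1)); last by rewrite V subrr oppr0.
by rewrite /beta_gf; ring.
Qed.

(** The boundary value left by the telescoping sum. Its 1 cancels the node itself, and its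
    [X * gfB 0] turns [m] copies of B(2) into [m - 1]. *)
Lemma ladder_gf0 : ladder_gf 0 = 1 + X * gfB 0.
Proof.
have -> : X * gfB 0 = (1 - X) * (X * C ^+ 2 + C * (X * C ^+ 2)) - X.
  by rewrite /gfB; ring.
by rewrite mulX_catalan_sq /ladder_gf; ring.
Qed.

Lemma gfB_rec k : gfB k = 1 + X * (gfA 2 0 + gfB k.+1 + k.+1%:R * gfB 0).
Proof.
have beta_eq : beta_gf - X * (beta_gf + gfB 0) = 0 by rewrite -beta_gf_eq subrr.
apply/eqP; rewrite -subr_eq0; apply/eqP.
(* The difference of the sides as a combination of the slope equation and the quadratic equation. *)
transitivity (k%:R * (beta_gf - X * (beta_gf + gfB 0))
    + (1 - X) * (C - 1 - X * C ^+ 2) * (C ^+ 2 + 2 * C + 2)).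
  by rewrite /gfA /ladder_gf /gfB -(natr1 k); ring.
by rewrite beta_eq mulX_catalan_sq subrr !mulr0 mul0r addr0.
Qed.

(** By [ladder_gf_rec] each term times [X] is a difference of neighbours. *)
Lemma sum_ladder_gf e n : (e < n)%N ->
  X * \sum_(e.+1 <= p < n) ladder_gf (n - p).+1 =
  ladder_gf (n - e).-1 - ladder_gf 0.
Proof.
move=> lt_en; rewrite mulr_sumr.
rewrite (@telescope_sumr_eq _ _ _ (fun p => - ladder_gf (n - p))) //.
  by rewrite subnn opprK addrC subnS.
move=> p /andP[_ lt_pn]; have -> : (n - p = (n - p.+1).+1)%N by lia.
by rewrite (ladder_gf_rec (n - p.+1)); ring.
Qed.

(** The groups of sites: before [t], inside [t], between [t] and [v], inside [v], at the end. *)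
Lemma sum_split (s e n : nat) (V : zmodType) (h : nat -> V) : (s <= e < n)%N ->
  \sum_(0 <= p < n.+1) h p = \sum_(0 <= p < s) h p + \sum_(s <= p < e) h p
    + h e + \sum_(e.+1 <= p < n) h p + h n.
Proof.
case/andP=> le_se lt_en; rewrite big_nat_recr //=; congr (_ + _).
rewrite (big_cat_nat (n := e)) //=; last exact: ltnW.
by rewrite (big_cat_nat (n := s)) //= (big_ltn lt_en) addrA.
Qed.

(** The rule for A(d, m) in the indices of a word of length [n]: d = n - e + 1 and m = e - s. *)
Lemma gfA_rec s e n : (s <= e < n)%N ->
  gfA (n - e).+1 (e - s) = 1 + X * (\sum_(s <= p < e) gfB 0
    + gfA (n - e).+1 (e - s).+1 + \sum_(e.+1 <= p < n) gfA (n - p).+1 1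
    + gfA (n - e).+2 0).
Proof.
move=> sen; have /andP[_ lt_en] := sen; rewrite sumr_const_nat -mulr_natl.
have -> : \sum_(e.+1 <= p < n) gfA (n - p).+1 1 =
  \sum_(e.+1 <= p < n) ladder_gf (n - p).+1.
  by apply: eq_bigr => p _; rewrite /gfA subrr mul0r addr0.
have [k def_k] : exists k, (n - e = k.+1)%N by exists (n - e).-1; lia.
rewrite !(mulrDr X) sum_ladder_gf // def_k /= ladder_gf0 /gfA.
(* Two unfoldings reach the [ladder_gf k] left by telescoping; what remains is [m - 1] times the
   slope equation. *)
rewrite {1}(ladder_gf_rec k.+1) {1}(ladder_gf_rec k) -(natr1 (e - s)) mulr0n.
move: (e - s)%:R (ladder_gf _) (ladder_gf _) (ladder_gf _) => m l0 l1 l2.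
apply/eqP; rewrite -subr_eq0; apply/eqP.
transitivity ((m - 1) * (beta_gf - X * (beta_gf + gfB 0))); first by ring.
by rewrite -beta_gf_eq subrr mulr0.
Qed.

(** Here [t] has e - s entries, so the state is B(e - s + 1), and [gfB] is offset by two. *)
Lemma gfB_rec_sum s e : (s < e)%N -> gfB (e - s).-1 =
  1 + X * (\sum_(s <= p < e) gfB 0 + gfB (e - s) + gfA 2 0).
Proof.
move=> lt_se; rewrite gfB_rec sumr_const_nat -mulr_natl.
have -> : ((e - s).-1.+1 = e - s)%N by lia.
by congr (1 + X * _); ring.
Qed.

(** Induction on the number [a] of values still to be inserted: each active site leads to a known
    state, and the recurrences give the next coefficient. *)
Lemma navoid_state a (w : seq nat) :
    {in w, forall b, (a < b)%N} -> uniq w -> avoiding w ->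
  (forall s e, stateA s e w ->
     (navoid a w)%:R = (gfA (size w - e).+1 (e - s))`@_a) /\
  (forall s e, stateB s e w -> (s < e)%N ->
     (navoid a w)%:R = (gfB (e - s).-1)`@_a).
Proof.
elim: a w => [|a IHa] w gt_a uniq_w av.
  have navoid1 : navoid 0 w = 1%N by rewrite navoid0; case: avoidsP.
  split=> s e [le_se lt_ew _ _ _ _] => [|lt_se]; rewrite navoid1.
    by rewrite gfA_rec ?le_se // fps_coefD fps_coefXM0 addr0.
  by rewrite gfB_rec_sum // fps_coefD fps_coefXM0 addr0.
have gt_ins p : {in insert_at p a.+1 w, forall b, (a < b)%N}.
  exact: insert_at_gt.
have uniq_ins p : uniq (insert_at p a.+1 w).
  have : perm_eq (insert_at p a.+1 w) (a.+1 :: w).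
    by rewrite perm_catC /= perm_cons perm_catC cat_take_drop.
  move/perm_uniq->; rewrite /= uniq_w andbT.
  by apply/negP=> /gt_a; rewrite ltnn.
have inactive p : ~ active p w -> (navoid a (insert_at p a.+1 w))%:R = 0 :> rat.
  by move=> nact; rewrite navoid_eq0 // => /(avoiding_insert_at p gt_a av).
have stepA p s e : active p w -> stateA s e (insert_at p a.+1 w) ->
    (navoid a (insert_at p a.+1 w))%:R = (gfA ((size w).+1 - e).+1 (e - s))`@_a.
  move=> act st; rewrite -(size_insert_at p a.+1).
  have av_ins : avoiding (insert_at p a.+1 w).
    exact/(avoiding_insert_at p gt_a av).
  by have [+ _] := IHa _ (gt_ins p) (uniq_ins p) av_ins; apply.
have stepB p s e : active p w -> stateB s e (insert_at p a.+1 w) -> (s < e)%N ->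
    (navoid a (insert_at p a.+1 w))%:R = (gfB (e - s).-1)`@_a.
  move=> act st lt_se.
  have av_ins : avoiding (insert_at p a.+1 w).
    exact/(avoiding_insert_at p gt_a av).
  by have [_ +] := IHa _ (gt_ins p) (uniq_ins p) av_ins; apply.
split=> s e st => [|lt_se]; have [le_se lt_ew act _ _ _] := st;
  rewrite navoidS natr_sum (@sum_split s e) ?le_se //.
- rewrite gfA_rec ?le_se // fps_coefD fps_coefXMS 3!fps_coefD !fps_coef_sum.
  rewrite fps_coef1 add0r.
  have -> : \sum_(0 <= p < s) (navoid a (insert_at p a.+1 w))%:R = 0 :> rat.
    by rewrite big_nat big1 // => p ps; apply: inactive; rewrite act; lia.
  (* The groups yield B(2), A(d, m + 1), the A(., 1) and A(d + 1, 0), in this order. *)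
  rewrite add0r; congr (_ + _ + _ + _).
  + apply: eq_big_nat => p sp; rewrite (stepB p p p.+1) ?subSnn //.
      by rewrite act; lia.
    exact (stateA_insert_top gt_a st sp).
  + rewrite (stepA e s e.+1) ?subSS ?subSn //; first by rewrite act; lia.
    exact (stateA_insert_sep gt_a st).
  + apply: eq_big_nat => p ep; rewrite (stepA p p p.+1) ?subSS ?subSnn //.
      by rewrite act; lia.
    exact (stateA_insert_dec gt_a st ep).
  + rewrite (stepA (size w) e e) ?subnn ?subSn //; try lia.
      by rewrite act; lia.
    exact (stateA_insert_end gt_a st).
rewrite gfB_rec_sum // fps_coefD fps_coefXMS 2!fps_coefD !fps_coef_sum.
rewrite fps_coef1 add0r.
have -> : \sum_(0 <= p < s) (navoid a (insert_at p a.+1 w))%:R = 0 :> rat.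
  by rewrite big_nat big1 // => p ps; apply: inactive; rewrite act; lia.
(* In state B the sites strictly inside [v] are inactive too. *)
have -> : \sum_(e.+1 <= p < size w) (navoid a (insert_at p a.+1 w))%:R
    = 0 :> rat.
  by rewrite big_nat big1 // => p ps; apply: inactive; rewrite act; lia.
rewrite add0r addr0; congr (_ + _ + _).
- apply: eq_big_nat => p sp; rewrite (stepB p p p.+1) ?subSnn //.
    by rewrite act; lia.
  exact (stateB_insert_top gt_a st sp).
- rewrite (stepB e s e.+1) ?subSn //; first by rewrite act; lia.
  exact (stateB_insert_sep gt_a uniq_w st).
- rewrite (stepA (size w) (size w) (size w)) ?subnn ?subSnn //.
    by rewrite act; lia.
  exact (stateB_insert_end gt_a st).
Qed.

Lemma navoid_nil n : (navoid n.+1 [::])%:R = (gfA 2 0)`@_n.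
Proof.
rewrite navoidS big_nat1.
have st : stateA 0 0 [:: n.+1].
  split=> //; try by move=> i j; rewrite /=; lia.
  move=> p _; split=> // _; split=> x y z /size_subseq.
    by rewrite size_drop /=; lia.
  by rewrite size_take_min /=; lia.
have gt_n : {in [:: n.+1], forall b, (n < b)%N}.
  by move=> b; rewrite inE => /eqP->.
have av : avoiding [:: n.+1] by move=> x y z t /size_subseq.
by have [/(_ _ _ st)] := navoid_state gt_n isT av.
Qed.

End GeneratingFunctions.

(** * The closed form *)

Theorem theorem31 :
  avoiders_gf [:: [:: 1; 3; 4; 2]; [:: 1; 4; 2; 3]; [:: 2; 3; 1; 4]]%N
  = (1 - 3 * fpsX + fpsX ^+ 2) / (1 - fpsX) * catalan_gf ^+ 3.
Proof.
set X : fps rat := fpsX; set C := catalan_gf.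
(* The 1 is the empty permutation; the factor [X] is the first inserted value, which gives the root
   A(2, 0). *)
have -> : avoiders_gf forbidden = 1 + X * gfA 2 0.
  apply/fpsP => -[|n]; rewrite fps_coefD ?fps_coefXM0 ?fps_coefXMS.
    by rewrite addr0 /= card_avoiders navoid0; case: avoidsP => // -[] [].
  by rewrite fps_coef1 add0r -navoid_nil /= card_avoiders.
have V : (1 - X) * (1 - X)^-1 = 1 by rewrite mulrV ?fps_1subX_unit.
apply/eqP; rewrite -subr_eq0; apply/eqP; set V' := (1 - X)^-1 in V *.
(* The difference of the sides as a combination of two vanishing expressions, [C - 1 - X * C ^+ 2]
   and [(1 - X) * V' - 1]. *)
transitivity (V' * (C - 1 - X * C ^+ 2) *
    (2 * X * C ^+ 2 - X ^+ 2 * C ^+ 2 - (C ^+ 2 + C + 1))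
  - ((1 - X) * V' - 1) * (1 + X * (1 - X) * C ^+ 4 - X * C ^+ 2)).
  by rewrite /gfA /ladder_gf /beta_gf -/X -/C -/V'; ring.
by rewrite V mulX_catalan_sq !subrr mulr0 !mul0r subr0.
Qed.
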